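(* Let $\lambda_1,\lambda_2,\kappa$ be cardinals with $\omega<\lambda_1<\lambda_2<\kappa$. Then the spaces $(X(\omega,\lambda_1))^*$ and $(X(\lambda_2,\kappa))^*$ (defined in the context) have non-comparable regularity ranks.
   Context: Regular and completely regular spaces are assumed to be $T_1$. Spaces $Y_1$ and $Y_2$ have non-comparable regularity ranks if both $Y_1$ and $Y_2$ are regular but not completely regular, and there does not exist a regular but not completely regular space $Z$ such that $Z$ is homeomorphic to a subspace of $Y_1$ and $Z$ is homeomorphic to a subspace of $Y_2$. For infinite cardinals $\lambda<\mu$ with $\mu$ uncountable, the space $X(\lambda,\mu)$ is defined as follows. Let $\{A(k):k\in\mathbb Z\}$ be a partition of $\mu$ into pairwise disjoint sets of cardinality $\mu$, and let $I(k,\lambda)$ be the ideal of all subsets of $A(k)$ of cardinality at most $\lambda$. Put $\Delta=\{(x,x):x\in\mu\}$ and $\Delta(k)=\Delta\cap A(k)^2$. The underlying set of $X(\lambda,\mu)$ is $\mu^2$, with the topology generated by the base consisting of all singletons $\{a\}$ with $a\in\mu^2\setminus\Delta$ and all sets $$\{(x,x)\}\cup\big(\{x\}\times(A(k-1)\setminus G)\big)\cup\big((A(k+1)\setminus F)\times\{x\}\big),$$ where $k\in\mathbb Z$, $x\in A(k)$, $|G|<\lambda$ and $F\in I(k+1,\lambda)$. The two-point extension $(X(\lambda,\mu))^*=X(\lambda,\mu)\cup\{-\infty,+\infty\}$ (with $\pm\infty$ distinct new points) has the following topology: open sets of $X(\lambda,\mu)$ are open; the sets $\{+\infty\}\cup\bigcup\{A(n)\times\mu:n>m\}$,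 $m\in\mathbb Z$, form a base at $+\infty$; the sets $\{-\infty\}\cup\big(\bigcup\{A(n)\times\mu:n\leqslant m\}\setminus\Delta(m)\big)$, $m\in\mathbb Z$, form a base at $-\infty$. *)

(* Defs.v *)
From HB Require Import structures.
From mathcomp Require Export all_boot all_order all_algebra.
From mathcomp Require Export all_classical all_reals all_analysis.

Set Implicit Arguments.
Unset Strict Implicit.
Unset Printing Implicit Defensive.

Import Order.TTheory GRing.Theory Num.Theory.
Import numFieldNormedType.Exports.

Local Open Scope classical_set_scope.
Local Open Scope card_scope.
Local Open Scope ring_scope.

(* A cardinal is represented by a type having that cardinality: the cardinal
   [lambda] is the cardinality of [[set: L]]. *)
Definition card_lt (T U : Type) (A : set T) (B : set U) : Prop :=
  A #<= B /\ ~ (B #<= A).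

Section Separation.

(* [regular_space] and [completely_regular_space] do not include T1. *)
Definition T1_regular (T : topologicalType) : Prop :=
  accessible_space T /\ regular_space T.

Definition T1_completely_regular (T : topologicalType) : Prop :=
  accessible_space T /\ completely_regular_space T.

(* [completely_regular_space] is stated with uniform separators; it is the
   usual separation by continuous functions into [0, 1]. *)
Lemma completely_regular_functionP (R : realType) (T : topologicalType) :
  completely_regular_space T <->
  forall (a : T) (B : set T), closed B -> ~ B a ->
    exists f : T -> R, [/\ continuous f, range f `<=` `[0, 1],
      f @` [set a] `<=` [set 0] & f @` B `<=` [set 1]].
Proof.
by split=> H a B cB Ba; apply/(@uniform_separatorP T R); exact: H.
Qed.

Definition regular_not_completely_regular (T : topologicalType) : Prop :=
  T1_regular T /\ ~ T1_completely_regular T.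

Definition homeomorphic (S T : topologicalType) : Prop :=
  exists (f : S -> T) (g : T -> S),
    [/\ continuous f, continuous g, cancel f g & cancel g f].

(* [set_type A] carries the subspace topology. *)
Definition homeomorphic_to_subspace (Z Y : topologicalType) : Prop :=
  exists A : set Y, homeomorphic Z (set_type A).

Definition non_comparable_regularity_ranks (Y1 Y2 : topologicalType) : Prop :=
  [/\ regular_not_completely_regular Y1,
      regular_not_completely_regular Y2 &
      ~ exists Z : topologicalType,
          [/\ regular_not_completely_regular Z,
              homeomorphic_to_subspace Z Y1 &
              homeomorphic_to_subspace Z Y2]].

End Separation.

Definition equipotent_partition (M : Type) (A : int -> set M) : Prop :=
  [/\ trivIset setT A, \bigcup_k A k = setT & forall k, A k #= [set: M]].

(* The space X(lambda, mu), with lambda = |L| and mu = |M|, built from the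
   partition A of M. *)
Definition spaceX (L M : Type) (A : int -> set M) : Type := (M * M)%type.

Section SpaceX.
Variables (L M : Type) (A : int -> set M).

Definition diagonal : set (M * M) := [set p | p.1 = p.2].

Definition diagonal_block (k : int) : set (M * M) :=
  diagonal `&` (A k `*` A k).

Definition small_ideal (k : int) : set (set M) :=
  [set F | F `<=` A k /\ F #<= [set: L]].

Definition basic_nbhd (k : int) (x : M) (G F : set M) : set (M * M) :=
  [set (x, x)] `|` ([set x] `*` (A (k - 1) `\` G))
               `|` ((A (k + 1) `\` F) `*` [set x]).

Definition spaceX_base : set (set (spaceX L A)) :=
  [set U | (exists2 a, ~ diagonal a & U = [set a]) \/
           (exists k x G F, [/\ A k x, card_lt G [set: L],
              small_ideal (k + 1) F & U = basic_nbhd k x G F])].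

HB.instance Definition _ := gen_eqMixin (spaceX L A).
HB.instance Definition _ := gen_choiceMixin (spaceX L A).

(* The coarsest topology in which the members of [spaceX_base] are open.
   For L infinite and A a partition, this family is a base of it. *)
HB.instance Definition _ :=
  isSubBaseTopological.Build (spaceX L A) spaceX_base id.

Inductive starX : Type :=
  | starX_pt of spaceX L A
  | starX_minfty
  | starX_pinfty.

Definition pinfty_base (m : int) : set starX :=
  [set starX_pinfty] `|`
  starX_pt @` (\bigcup_(n in [set n : int | m < n]) (A n `*` [set: M])).

Definition minfty_base (m : int) : set starX :=
  [set starX_minfty] `|`
  starX_pt @` ((\bigcup_(n in [set n : int | n <= m]) (A n `*` [set: M]))
                 `\` diagonal_block m).

Definition starX_base : set (set starX) :=
  [set W | [\/ exists2 U : set (spaceX L A), open U & W = starX_pt @` U,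
               exists m, W = pinfty_base m |
               exists m, W = minfty_base m]].

HB.instance Definition _ := gen_eqMixin starX.
HB.instance Definition _ := gen_choiceMixin starX.

(* The traces on [spaceX L A] of the basic sets at the two infinite points are
   open and the basic sets at one infinite point are nested, so [starX_base] is
   a base of this topology, and the [pinfty_base m] (resp. [minfty_base m]) form
   a base at [starX_pinfty] (resp. [starX_minfty]). *)
HB.instance Definition _ := isSubBaseTopological.Build starX starX_base id.

End SpaceX.

(* Main.v *)
Require Import Defs.
From mathcomp Require Import zify Rstruct.

Set Implicit Arguments.
Unset Strict Implicit.
Unset Printing Implicit Defensive.

Import Order.TTheory GRing.Theory Num.Theory.
Import numFieldNormedType.Exports.

Local Open Scope classical_set_scope.
Local Open Scope card_scope.

(** Both spaces are T1 and regular because their basic sets are almost clopen: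
    the cross around a diagonal point is clopen, and the basic neighbourhoods of
    the two infinite points are complementary up to one block of the diagonal
    ([starX_regular]).

    Neither is completely regular, because a continuous real function cannot be
    larger at plus infinity than at minus infinity
    ([continuous_pinfty_le_minfty]).  A continuous function that is at most c at
    |L| points of the diagonal of one block is at most any c' > c at |L| points
    of the diagonal of the next block ([large_sublevel_next_block]); this
    counting argument uses that |L| x |L| = |L| < |M|, whence Hessenberg's
    theorem ([card_le_setX_self]).

    A common subspace Z has at most |L1| points, since the first space has, and
    |L1| < |L2|.  In the second space, a neighbourhood of a diagonal point may
    omit any set of fewer than |L2| points on its arms.  Hence all points of Z
    but the two infinite ones are isolated in Z ([small_subspace_isolated]), so
    Z has a base of clopen sets and is completely regular. *)

(** * Arithmetic of infinite cardinals *)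

Lemma card_leT_fun (T U : Type) (B : set U) : [set: T] #<= B ->
  exists2 f : T -> U, injective f & forall x, B (f x).
Proof.
move=> /card_leP[f]; exists (fun x => val (f (SigSub (mem_set (I : setT x))))).
  move=> x y /val_inj /(in2TT 'inj_f) fxy.
  exact: (congr1 val fxy).
by move=> x; exact: set_valP.
Qed.

Lemma card_le_fun (T U : Type) (u : U) (A : set T) (B : set U) : A #<= B ->
  exists2 f : T -> U, {in A &, injective f} & forall x, A x -> B (f x).
Proof.
rewrite -(card_le_eql (card_setT A)) => /card_leT_fun[f finj fB].
exists (fun x =>
  if pselect (A x) is left Ax then f (SigSub (mem_set Ax)) else u).
  move=> x y /set_mem Ax /set_mem Ay.
  by case: pselect => // ?; case: pselect => // ? /finj [].
by move=> x Ax; case: pselect.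
Qed.

(** A relational form of injectivity, which needs no default value in U. *)
Lemma rel_card_le (T U : Type) (A : set T) (B : set U) (R : T -> U -> Prop) :
  (forall x, A x -> exists2 y, B y & R x y) ->
  (forall x x' y, A x -> A x' -> R x y -> R x' y -> x = x') -> A #<= B.
Proof.
elim/Ppointed: U => U in B R *.
  move=> tot _; rewrite emptyE; apply/eqP; rewrite -subset0 => x /tot[y _ _].
  exact: no y.
move=> tot inj; apply/pcard_leP/injfunPex.
have /choice[f fP] : forall x, exists y, A x -> B y /\ R x y.
  move=> x; have [/tot[y By Rxy]|nAx] := pselect (A x); first by exists y.
  by exists point.
exists f; first by move=> x /fP[].
move=> x x' /[dup] /set_mem Ax /set_mem/fP[_ Rx].
move=> /[dup] /set_mem Ax' /set_mem/fP[_ Rx'] fxx'.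
by apply: (inj x x' (f x)) => //; rewrite fxx'.
Qed.

Lemma fun_card_le (T U : Type) (A : set T) (B : set U) (f : T -> U) :
  {in A &, injective f} -> (forall x, A x -> B (f x)) -> A #<= B.
Proof.
move=> finj fB; apply: (@rel_card_le _ _ _ _ (fun x y => f x = y)).
  by move=> x /fB; exists (f x).
by move=> x x' y Ax Ax' <- /esym; apply: finj; exact: mem_set.
Qed.

(** A maximal partial injection from A to B, given by its graph, is defined on
    all of A or reaches all of B. *)
Lemma card_le_total (T U : Type) (A : set T) (B : set U) :
  A #<= B \/ B #<= A.
Proof.
pose P : set (set (T * U)) := [set G | G `<=` A `*` B /\
  forall p q, G p -> G q -> p.1 = q.1 <-> p.2 = q.2].
have [F FP totF|G [[GAB Ginj] Gmax]] := @Zorn_bigcup _ P.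
  split=> [p [X /FP[+ _]]|p q [X FX Xp] [Y FY Yq]]; first exact.
  have [XY|YX] := totF _ _ FX FY.
    by apply: (FP _ FY).2 => //; exact: XY.
  by apply: (FP _ FX).2 => //; exact: YX.
have [domG|/existsNP[a /not_implyP[Aa /forallNP Ga]]] :=
    pselect (forall x, A x -> exists y, G (x, y)).
  left; apply: (@rel_card_le _ _ _ _ (fun x y => G (x, y))).
    by move=> x /domG[y Gxy]; exists y => //; have [] := GAB _ Gxy.
  by move=> x x' y _ _ Gx Gx'; exact/(Ginj _ _ Gx Gx').
have [ranG|/existsNP[b /not_implyP[Bb /forallNP Gb]]] :=
    pselect (forall y, B y -> exists x, G (x, y)).
  right; apply: (@rel_card_le _ _ _ _ (fun y x => G (x, y))).
    by move=> y /ranG[x Gxy]; exists x => //; have [] := GAB _ Gxy.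
  by move=> y y' x _ _ Gy Gy'; exact/(Ginj _ _ Gy Gy').
exfalso; apply: (Gmax (G `|` [set (a, b)])).
  by split=> [|/(_ (a, b))]; [exact: subsetUl|move=> /(_ (or_intror erefl))/Ga].
split=> [p [/GAB//|->//]|[x y] [x' y'] /= [Gp|[-> ->]] [Gq|[-> ->]]] //=.
- exact: (Ginj _ _ Gp Gq).
- by split=> E; subst; [case: (Ga y)|case: (Gb x)].
- by split=> E; subst; [case: (Ga y')|case: (Gb x')].
Qed.

(** The pairing is total on T, to keep the carriers plain subsets; only its
    values on A x A are meaningful. *)
Definition pairing_on (T : Type) (A : set T) (f : T -> T -> T) : Prop :=
  (forall x y, A x -> A y -> A (f x y)) /\
  forall x y x' y', A x -> A y -> A x' -> A y' ->
    f x y = f x' y' -> x = x' /\ y = y'.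

(** With h an injection of A into its complement, the pairing extends to A and
    its copy h(A).  A pair with a coordinate in h(A) is pulled back to A x A,
    paired there together with a tag in A recording which coordinates were in
    h(A), and the result is sent to h(A), so it meets no old value. *)
Lemma pairing_on_extend (T : Type) (A : set T) (f : T -> T -> T) (a b : T) :
  [/\ A a, A b & pairing_on A f] -> a <> b -> A #<= ~` A ->
  exists A' f', [/\ A `<=` A', pairing_on A' f',
    forall x y, A x -> A y -> f' x y = f x y & exists2 x, A' x & ~ A x].
Proof.
move=> [Aa Ab [fA f_inj]] ab AB.
have [h h_inj hA] := card_le_fun a AB.
have {}h_inj x y : A x -> A y -> h x = h y -> x = y.
  by move=> Ax Ay; apply: h_inj; exact: mem_set.
pose A' := A `|` h @` A.
have A'A x : A x -> A' x by left.
have [k [kA k_inj]] : exists k : T -> T, (forall x, A' x -> A (k x)) /\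
    (forall x y, A' x -> A' y -> (A x <-> A y) -> k x = k y -> x = y).
  have /choice[k kP] : forall x, exists y,
      (A x -> y = x) /\ ((h @` A) x -> A y /\ h y = x).
    move=> x; have [[y Ay <-]|nhx] := pselect ((h @` A) x).
      by exists y; split=> // Ahy; have := hA _ Ay.
    by exists x.
  exists k; split=> [x [Ax|/(kP _).2[]//]|]; first by rewrite (kP _).1.
  move=> x y [Ax|hx] [Ay|hy] AxAy.
  - by rewrite !(kP _).1.
  - by have := AxAy.1 Ax; case: hy => z Az <- /(hA _ Az).
  - by have := AxAy.2 Ay; case: hx => z Az <- /(hA _ Az).
  - have [_ hkx] := (kP x).2 hx; have [_ hky] := (kP y).2 hy.
    by move=> kxy; rewrite -hkx -hky kxy.
(* Three classes of pairs lie outside A x A; f separates the tags since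
   a <> b. *)
pose tag x y := if pselect (A x) is left _ then f a b
                else if pselect (A y) is left _ then f b a else f a a.
have tagA x y : A (tag x y) by rewrite /tag; do 2?case: pselect => *; exact: fA.
pose f' x y := if pselect (A x /\ A y) is left _ then f x y
               else h (f (tag x y) (f (k x) (k y))).
have f'E x y : A x -> A y -> f' x y = f x y.
  by rewrite /f'; case: pselect => // nA Ax Ay; case: nA.
have hA' x y : A' x -> A' y -> A (f (tag x y) (f (k x) (k y))).
  by move=> A'x A'y; apply: (fA); [exact: tagA|apply: fA; exact: kA].
have f'P : pairing_on A' f'.
  split=> [x y A'x A'y|x y x' y' A'x A'y A'x' A'y'].
    rewrite /f'; case: pselect => [[Ax Ay]|_]; first by left; exact: fA.
    by right; exists (f (tag x y) (f (k x) (k y))) => //; exact: hA'.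
  rewrite /f'; case: pselect => [[Ax Ay]|nA]; case: pselect => [[Ax' Ay']|nA'].
  - exact: f_inj.
  - by move=> fE; case: (hA _ (hA' _ _ A'x' A'y')); rewrite -fE; exact: fA.
  - by move=> fE; case: (hA _ (hA' _ _ A'x A'y)); rewrite fE; exact: fA.
  - move=> /(h_inj _ _ (hA' _ _ A'x A'y) (hA' _ _ A'x' A'y')).
    have kkA u v : A' u -> A' v -> A (f (k u) (k v)).
      by move=> A'u A'v; apply: fA; exact: kA.
    move=> /f_inj[]; [exact: tagA|exact: kkA|exact: tagA|exact: kkA|].
    move=> tE /f_inj[]; [exact: kA|exact: kA|exact: kA|exact: kA|].
    suff [xx' yy'] : (A x <-> A x') /\ (A y <-> A y').
      by move=> /(k_inj _ _ A'x A'x' xx')-> /(k_inj _ _ A'y A'y' yy')->.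
    move: tE; rewrite /tag; do 4?case: pselect => ?;
      try (by move=> _; split; split=> //; tauto);
      move=> /f_inj[] // *; exfalso; try apply: ab; congruence.
exists A', f'; split=> //; exists (h a); last exact: hA.
by right; exists a.
Qed.

(** Hessenberg's theorem, by Zorn's lemma on the subsets A equipped with an
    injective pairing A x A -> A, ordered by extension.  If the complement of a
    maximal A embeds in A, the pairing embeds T in A, so T x T in A.  Otherwise
    A embeds in its complement and can be extended. *)
Lemma card_le_setX_self (T : Type) : infinite_set [set: T] ->
  [set: T * T] #<= [set: T].
Proof.
move=> /infiniteP/card_leT_fun[e e_inj _].
pose a := e 0%N; pose b := e 1%N.
have ab : a <> b by move=> /e_inj.
(* The two fixed elements exclude the carriers with at most one point, on which
   a maximal pairing would say nothing. *)
pose S := {Af : set T * (T -> T -> T) |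
             [/\ Af.1 a, Af.1 b & pairing_on Af.1 Af.2]}.
pose ext (s t : S) := (sval s).1 `<=` (sval t).1 /\
  forall x y, (sval s).1 x -> (sval s).1 y ->
              (sval t).2 x y = (sval s).2 x y.
have ext_refl s : ext s s by split.
have ext_trans r s t : ext r s -> ext s t -> ext r t.
  move=> [rs rsE] [st stE]; split; first exact: subset_trans st.
  by move=> x y rx ry; rewrite stE ?rsE//; exact: rs.
have [c c_inj] : exists c : nat * nat -> nat, injective c.
  have := card_nat2; rewrite card_eq_le => /andP[/card_leT_fun[c cinj _] _].
  by exists c.
have [s0 _] : exists s0 : S, True.
  have /choice[e' e'K] : forall x, exists n, range e x -> e n = x.
    move=> x; have [[n _ enx]|] := pselect (range e x); first by exists n.
    by exists 0%N.
  unshelve eexists (exist _ (range e, fun x y => e (c (e' x, e' y))) _) => //=.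
  split; [by exists 0%N|by exists 1%N|split=> [x y _ _|]]; first by eexists.
  move=> x y x' y' rx ry rx' ry' /e_inj/c_inj[Ex Ey].
  by rewrite -(e'K x)// -(e'K y)// Ex Ey !e'K.
have [|||[[A f] AfP] maxA] :=
  @ZL_preorder S s0 (fun s t => `[< ext s t >]).
- by move=> s; exact/asboolP.
- move=> r s t /asboolP rs /asboolP st.
  exact/asboolP/(ext_trans _ _ _ rs st).
- move=> F totF; have [[s1 Fs1]|F0] := pselect (exists s, F s); last first.
    by exists s0 => s Fs; case: F0; exists s.
  have {}totF s t : F s -> F t -> ext s t \/ ext t s.
    move=> Fs Ft; have [/asboolP|/asboolP] := totF _ _ Fs Ft; by [left|right].
  pose A := \bigcup_(s in F) (sval s).1.
  have common2 x y : A x -> A y ->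
      exists s, [/\ F s, (sval s).1 x & (sval s).1 y].
    move=> [s Fs sx] [t Ft ty]; have [[st _]|[ts _]] := totF _ _ Fs Ft.
      by exists t; split=> //; exact: st.
    by exists s; split=> //; exact: ts.
  have /choice[g gP] : forall p : T * T, exists z,
      forall s, F s -> (sval s).1 p.1 -> (sval s).1 p.2 ->
                (sval s).2 p.1 p.2 = z.
    move=> [x y]; have [[s [Fs sx sy]]|no] :=
      pselect (exists s, [/\ F s, (sval s).1 x & (sval s).1 y]); last first.
      by exists x => s Fs sx sy; case: no; exists s.
    exists ((sval s).2 x y) => t Ft tx ty /=.
    by have [[_ ->//]|[_ ->//]] := totF _ _ Fs Ft.
  have gE s x y : F s -> (sval s).1 x -> (sval s).1 y ->
      g (x, y) = (sval s).2 x y by move=> Fs sx sy; rewrite (gP (x, y) s).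
  unshelve eexists (exist _ (A, fun x y => g (x, y)) _); last first.
    move=> s Fs; apply/asboolP; split=> /= [x sx|x y sx sy]; first by exists s.
    exact: gE.
  have [s1a s1b _] := svalP s1.
  split=> /=; [by exists s1|by exists s1|split].
    move=> x y Ax Ay; have [s [Fs sx sy]] := common2 _ _ Ax Ay.
    by exists s => //; rewrite (gE s)//; have [_ _ [+ _]] := svalP s; exact.
  move=> x y x' y' Ax Ay Ax' Ay'.
  have [s [Fs sx sy]] := common2 _ _ Ax Ay.
  have [t [Ft tx ty]] := common2 _ _ Ax' Ay'.
  rewrite (gE s)// (gE t)//.
  have [[st stE]|[ts tsE]] := totF _ _ Fs Ft.
    rewrite -stE//; have [_ _ [_ +]] := svalP t; apply=> //; exact: st.
  rewrite -tsE//; have [_ _ [_ +]] := svalP s; apply=> //; exact: ts.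
have /= [Aa Ab [fA f_inj]] := AfP.
have [BA|AB] := card_le_total (~` A) A.
  have [h h_inj hA] := card_le_fun a BA.
  pose i x := if pselect (A x) is left _ then f a x else f b (h x).
  have iA x : A (i x).
    by rewrite /i; case: pselect => // nAx; apply: fA => //; exact: hA.
  have i_inj : injective i.
    move=> x y; rewrite /i; case: pselect => Ax; case: pselect => Ay.
    - by move=> /f_inj[].
    - by move=> /f_inj[]//; exact: hA.
    - by move=> /f_inj[]//; [exact: hA|move=> /esym].
    - move=> /f_inj[]//; [exact: hA|exact: hA|move=> _].
      by apply: h_inj; exact: mem_set.
  apply: (@fun_card_le _ _ _ _ (fun p => f (i p.1) (i p.2))) => //.
  by move=> [x y] [x' y'] _ _ /f_inj[]//= /i_inj-> /i_inj->.
have [A' [f' [A'A f'P f'E [x A'x nAx]]]] := pairing_on_extend AfP ab AB.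
have [A'A' _] : ext (exist _ (A', f') (And3 (A'A _ Aa) (A'A _ Ab) f'P))
                    (exist _ (A, f) AfP).
  by apply/asboolP/maxA/asboolP; split.
by case: nAx; exact: A'A'.
Qed.

(** Identify L with L x L: either some row lies in A, or every row has a point
    in B. *)
Lemma card_le_setU_infinite (L M : Type) (A B : set M) :
  infinite_set [set: L] -> [set: L] #<= A `|` B ->
  [set: L] #<= A \/ [set: L] #<= B.
Proof.
move=> /card_le_setX_self/card_leT_fun[h h_inj _] /card_leT_fun[i i_inj iAB].
have [[x xA]|/forallNP noA] := pselect (exists x, forall y, A (i (h (x, y)))).
  left; apply: (fun_card_le (f := fun y => i (h (x, y)))) => //.
  by move=> y y' _ _ /i_inj/h_inj[].
right.
have /choice[y yB] : forall x, exists y, B (i (h (x, y))).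
  by move=> x; have /existsNP[y nA] := noA x; exists y; case: (iAB (h (x, y))).
apply: (fun_card_le (f := fun x => i (h (x, y x)))) => //.
by move=> x x' _ _ /i_inj/h_inj[].
Qed.

Lemma card_bigcup_le_infinite (I L T : Type) (D : set I) (F : I -> set T) :
  infinite_set [set: L] -> D #<= [set: L] ->
  (forall i, D i -> F i #<= [set: L]) -> \bigcup_(i in D) F i #<= [set: L].
Proof.
move=> Linf DL FL; have [l0 _] := infinite_setN0 Linf.
apply: card_le_trans (card_le_setX_self Linf).
have [d d_inj _] := card_le_fun l0 DL.
have /choice[g gP] : forall i, exists g : T -> L,
    D i -> {in F i &, injective g}.
  move=> i; have [/FL/(card_le_fun l0)[g g_inj _]|] := pselect (D i).
    by exists g.
  by exists (fun=> l0).
apply: (@rel_card_le _ _ _ _ (fun x p => exists2 i, D i &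
          F i x /\ p = (d i, g i x))) => [x [i Di Fix]|x x' p _ _].
  by exists (d i, g i x) => //; exists i.
move=> [i Di [Fix ->]] [j Dj [Fjx' []]] /d_inj ij.
rewrite -ij ?inE// in Fjx' * => /gP; apply => //; exact: mem_set.
Qed.

Lemma card_setU_le_infinite (L T : Type) (A B : set T) :
  infinite_set [set: L] -> A #<= [set: L] -> B #<= [set: L] ->
  A `|` B #<= [set: L].
Proof.
move=> Linf AL BL.
have -> : A `|` B = \bigcup_(b in [set: bool]) if b then A else B.
  apply/seteqP; split=> [x [Ax|Bx]|x [[] _]];
    by [exists true|exists false|left|right].
apply: card_bigcup_le_infinite => // [|[] _//].
exact: card_le_trans (countableP _) ((infiniteP _).1 Linf).
Qed.

Lemma card_lt_setU (L T : Type) (A B : set T) : infinite_set [set: L] ->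
  card_lt A [set: L] -> card_lt B [set: L] -> card_lt (A `|` B) [set: L].
Proof.
move=> Linf [AL LA] [BL LB]; split; first exact: card_setU_le_infinite.
by case/card_le_setU_infinite.
Qed.

Lemma card_lt_finite (L T : Type) (A : set T) : infinite_set [set: L] ->
  finite_set A -> card_lt A [set: L].
Proof.
move=> Linf Afin; split; last by move=> /card_le_finite/(_ Afin).
exact: card_le_trans (finite_set_countable Afin) ((infiniteP _).1 Linf).
Qed.

(** * Topologies given by a subbase, closures *)

Definition subbase_of (T : topologicalType) (B : set (set T)) : Prop :=
  forall W : set T, open W <->
    exists2 D, D `<=` finI_from B id & \bigcup_(V in D) V = W.

Lemma spaceX_subbase (L M : Type) (A : int -> set M) :
  subbase_of (@spaceX_base L M A).
Proof. by []. Qed.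

Lemma starX_subbase (L M : Type) (A : int -> set M) :
  subbase_of (@starX_base L M A).
Proof. by []. Qed.

Lemma subbase_open (T : topologicalType) (B : set (set T)) (W : set T) :
  subbase_of B -> B W -> open W.
Proof.
move=> BP BW; apply/BP; exists [set W]; last by rewrite bigcup_set1.
by move=> _ ->; exact: finI_from1.
Qed.

(** Neighbourhoods of p are generated by the members of the subbase around p, so
    it is enough to test those against a filter. *)
Lemma subbase_nbhs (T : topologicalType) (B : set (set T)) (p : T)
    (F : set_system T) : subbase_of B -> Filter F ->
  (forall W, B W -> W p -> F W) -> F --> p.
Proof.
move=> BP FF BF V; rewrite /= nbhsE => -[W [/BP[D DB <-] [U DU Up]] WV].
apply: filterS (subset_trans (bigcup_sup DU) WV) _.
have [E EB UE] := DB _ DU; rewrite -UE in Up *.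
by apply: filter_bigI => i Ei; apply: BF; [exact/set_mem/EB|exact: Up].
Qed.

Lemma closure_sub_open (T : topologicalType) (U V W : set T) :
  open V -> U `&` V = set0 -> V `|` W = setT -> closure U `<=` W.
Proof.
move=> oV UV VW; have : closure U `<=` ~` V.
  rewrite [~` V](closure_id _).1; last exact: open_closedC.
  exact/closureS/disjoints_subset.
by move=> UVc p /UVc Vp; have [] : (V `|` W) p by rewrite VW.
Qed.

(** * Neighbourhoods in the two-point extension *)

Section StarX.
Variables (L M : Type) (A : int -> set M).
Hypothesis Linf : infinite_set [set: L].
Hypothesis partA : equipotent_partition A.

Local Notation pt := (@starX_pt L M A).
Local Notation minfty := (@starX_minfty L M A).
Local Notation pinfty := (@starX_pinfty L M A).
Local Notation cross := (basic_nbhd A).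
Local Notation Upinfty := (@pinfty_base L M A).
Local Notation Uminfty := (@minfty_base L M A).
Local Open Scope ring_scope.

Lemma block_inj j k x : A j x -> A k x -> j = k.
Proof.
have [/trivIsetP tA _ _] := partA; move=> Ajx Akx.
apply: contrapT => /eqP jk.
by have /seteqP[/(_ x) + _] := tA j k I I jk; apply; split.
Qed.

Lemma block_ex x : exists k, A k x.
Proof.
have [_ covA _] := partA; have : [set: M] x by [].
by rewrite -covA => -[k _ Akx]; exists k.
Qed.

Lemma card_block k : [set: M] #<= A k.
Proof. by have [_ _ /(_ k)] := partA; rewrite card_eq_le => /andP[]. Qed.

Lemma block_neq j k x y : j != k -> A j x -> A k y -> x <> y.
Proof.
move=> /eqP jk Ajx Aky xy; apply: jk; apply: (@block_inj _ _ x) => //.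
by rewrite xy.
Qed.

Definition admissible (k : int) (GF : set M * set M) : Prop :=
  card_lt GF.1 [set: L] /\ small_ideal L A (k + 1) GF.2.

Definition cross_filter (k : int) (x : M) : set_system (M * M) :=
  filter_from (admissible k) (fun GF => cross k x GF.1 GF.2).

Lemma admissible0 k : admissible k (set0, set0).
Proof. by split; [exact: card_lt_finite|split]. Qed.

(** Both smallness conditions are stable under finite unions. *)
Lemma cross_filter_filter k x : Filter (cross_filter k x).
Proof.
apply: filter_from_filter; first by exists (set0, set0); exact: admissible0.
move=> [G F] [G' F'] [GL [FA FL]] [G'L [F'A F'L]] /=.
exists (G `|` G', F `|` F').
  split; first exact: card_lt_setU.
  by split; [rewrite subUset|exact: card_setU_le_infinite].
move=> [a b] /=.
case=> [[//|[/= ax [bA /not_orP[bG bG']]]]|[[/= aA /not_orP[aF aF']] bx]].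
- by split; left; left.
- by split; left; right.
- by split; right.
Qed.

Lemma crossP k x G F p : cross k x G F p ->
  [\/ p = (x, x), p.1 = x /\ (A (k - 1) `\` G) p.2 |
      (A (k + 1) `\` F) p.1 /\ p.2 = x].
Proof.
by case=> [[->|[? ?]]|[? ?]]; [constructor 1|constructor 2|constructor 3].
Qed.

Lemma cross_center k x G F : cross k x G F (x, x).
Proof. by left; left. Qed.

Lemma cross_offdiag k x G F p :
  A k x -> cross k x G F p -> diagonal p -> p = (x, x).
Proof.
move=> Akx /crossP[//|[+ [+ _]]|[[+ _] +]]; case: p => [a b] /=.
  by move=> -> bA /= xb; case: (block_neq _ Akx bA xb); lia.
by move=> aA -> /= ax; case: (block_neq _ Akx aA); rewrite ?ax//; lia.
Qed.

Lemma cross_block k x G F p : A k x -> cross k x G F p ->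
  A k p.1 \/ A (k + 1) p.1.
Proof. by move=> Akx /crossP[->|[-> _]|[[? _] _]]; [left|left|right]. Qed.

Lemma open_pt_singleton p : ~ diagonal p -> open [set pt p].
Proof.
move=> np; apply: (subbase_open (@starX_subbase L M A)); constructor 1.
exists [set p]; last by rewrite image_set1.
by apply: (subbase_open (@spaceX_subbase L M A)); left; exists p.
Qed.

Lemma open_cross k x G F : A k x -> admissible k (G, F) ->
  open (pt @` cross k x G F).
Proof.
move=> Akx [GL FI]; apply: (subbase_open (@starX_subbase L M A)); constructor 1.
exists (cross k x G F) => //.
apply: (subbase_open (@spaceX_subbase L M A)); right.
by exists k, x, G, F.
Qed.

Lemma open_pinfty_base m : open (Upinfty m).
Proof.
by apply: (subbase_open (@starX_subbase L M A)); constructor 2; exists m.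
Qed.

Lemma open_minfty_base m : open (Uminfty m).
Proof.
by apply: (subbase_open (@starX_subbase L M A)); constructor 3; exists m.
Qed.

Lemma pinfty_base_pt m k p : A k p.1 -> Upinfty m (pt p) <-> m < k.
Proof.
move=> Akp; split=> [[//|[q [n /= mn [Anp _]] [qp]]]|mk].
  by rewrite qp in Anp; rewrite (block_inj Akp Anp).
by right; exists p => //; exists k.
Qed.

Lemma minfty_base_pt m k p : A k p.1 -> Uminfty m (pt p) <->
  k <= m /\ ~ (k = m /\ diagonal p).
Proof.
move=> Akp; split=> [[//|[q [[n /= nm [Anp _]] nD] [qp]]]|[km nD]].
  rewrite qp in Anp nD; rewrite (block_inj Akp Anp); split=> // -[kn Dp].
  apply: nD; split=> //; rewrite -kn; split=> //.
  by rewrite -(Dp : p.1 = p.2).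
right; exists p => //; split; first by exists k.
move=> [Dp [Amp _]]; apply: nD; split=> //; exact: block_inj Akp Amp.
Qed.

Lemma pinfty_base_sub m m' : m <= m' ->
  Upinfty m' `<=` Upinfty m.
Proof.
move=> mm' [p| |]; [|by case=> // -[]|by left].
have [k Akp] := block_ex p.1; rewrite !(pinfty_base_pt _ Akp); lia.
Qed.

Lemma minfty_base_sub m m' : m <= m' ->
  Uminfty m `<=` Uminfty m'.
Proof.
move=> mm' [p| |]; [|by left|by case=> // -[]].
have [k Akp] := block_ex p.1; rewrite !(minfty_base_pt _ Akp) => -[km nD].
split; first lia.
move=> [km' Dp]; apply: nD; split=> //; lia.
Qed.

(** The point to check is that the basic sets at infinity contain the whole
    cross of each of their diagonal points: the first coordinates on a cross
    are of level k or k + 1, and a diagonal point of level k in [Uminfty m] has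
    k < m because the diagonal of level m is removed there. *)
Lemma nbhs_diag k x W : A k x ->
  nbhs (pt (x, x)) W <-> (pt @ cross_filter k x) W.
Proof.
move=> Akx; split; last first.
  move=> [[G F] adm sW]; apply: (@filterS _ _ _ (pt @` cross k x G F)).
    exact/image_subP.
  apply: open_nbhs_nbhs; split; first exact: open_cross.
  exact: imageP (cross_center _ _ _ _).
have cF := cross_filter_filter k x; move: W.
apply: (subbase_nbhs (@starX_subbase L M A) (fmap_filter pt cF)) => W.
case=> [[U oU ->] [q Uq [qE]]|[m ->]|[m ->]].
- rewrite qE in Uq; have : cross_filter k x U.
    suff : nbhs ((x, x) : spaceX L A) `<=` cross_filter k x.
      by apply; exact: open_nbhs_nbhs.
    apply: (subbase_nbhs (@spaceX_subbase L M A) cF) => V.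
    case=> [[a na ->] /= ax|[j [z [G [F [Ajz GL FI ->]]]]]].
      by case: na; rewrite -ax.
    move=> /(cross_offdiag Ajz)/(_ erefl)[xz]; rewrite -xz in Ajz *.
    by rewrite (block_inj Akx Ajz); exists (G, F).
  by apply: filterS => p Up; exists p.
- move=> /(pinfty_base_pt _ (p := (x, x)) Akx) mk.
  exists (set0, set0); first exact: admissible0.
  move=> p /(cross_block Akx)[Ap|Ap]; apply/(pinfty_base_pt _ Ap); lia.
- move=> /(minfty_base_pt _ (p := (x, x)) Akx)[km nD].
  exists (set0, set0); first exact: admissible0.
  have {}km : k < m by have /eqP : k <> m by [move=> E; apply: nD]; lia.
  move=> p xp; have [Ap|Ap] := cross_block Akx xp; apply/(minfty_base_pt _ Ap).
    by split; [lia|case; lia].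
  split; first lia.
  move=> [_ /(cross_offdiag Akx xp) pE]; rewrite pE in Ap.
  by have := block_inj Akx Ap; lia.
Qed.

Lemma nbhs_pinfty (W : set (starX L A)) :
  nbhs pinfty W -> exists m, Upinfty m `<=` W.
Proof.
suff: nbhs pinfty `<=` filter_from setT (@pinfty_base L M A).
  by move=> + pW => /(_ _ pW)[m _ mW]; exists m.
apply: (subbase_nbhs (@starX_subbase L M A)).
  apply: filter_from_filter => [|i j _ _]; first by exists 0.
  exists (Num.max i j) => //; rewrite subsetI; split;
    apply: pinfty_base_sub; lia.
by move=> V [[U _ ->] [//]|[m ->] _|[m ->] [//|[//]]]; exists m.
Qed.

Lemma nbhs_minfty (W : set (starX L A)) :
  nbhs minfty W -> exists m, Uminfty m `<=` W.
Proof.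
suff: nbhs minfty `<=` filter_from setT (@minfty_base L M A).
  by move=> + pW => /(_ _ pW)[m _ mW]; exists m.
apply: (subbase_nbhs (@starX_subbase L M A)).
  apply: filter_from_filter => [|i j _ _]; first by exists 0.
  exists (Num.min i j) => //; rewrite subsetI; split;
    apply: minfty_base_sub; lia.
by move=> V [[U _ ->] [//]|[m ->] [//|[//]]|[m ->] _]; exists m.
Qed.

Lemma open_starXP (W : set (starX L A)) :
  [/\ forall k x, A k x -> W (pt (x, x)) ->
        exists2 GF, admissible k GF & pt @` cross k x GF.1 GF.2 `<=` W,
      W pinfty -> exists m, Upinfty m `<=` W &
      W minfty -> exists m, Uminfty m `<=` W] -> open W.
Proof.
move=> [Wdiag Wp Wm]; rewrite openE => -[[x y]| |] Wx; rewrite /interior.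
- have [yx|xy] := pselect (y = x).
    rewrite yx in Wx *; have [k Akx] := block_ex x; apply/(nbhs_diag _ Akx).
    have [GF adm sW] := Wdiag _ _ Akx Wx; exists GF => // p xp.
    by apply: sW; exists p.
  apply: (@filterS _ _ _ [set pt (x, y)]); first by move=> _ ->.
  by apply: open_nbhs_nbhs; split=> //; apply: open_pt_singleton => /= /esym.
- have [m mW] := Wm Wx; apply: (filterS mW); apply: open_nbhs_nbhs.
  by split; [exact: open_minfty_base|left].
- have [m mW] := Wp Wx; apply: (filterS mW); apply: open_nbhs_nbhs.
  by split; [exact: open_pinfty_base|left].
Qed.

(** Removing a single point from each arm is always admissible. *)
Lemma admissible_avoid k (a b : M) : exists2 GF, admissible k GF &
  forall x y, A k x -> cross k x GF.1 GF.2 y -> y = (x, x) \/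
    [/\ y.1 = x, A (k - 1) y.2 & y.2 <> a] \/
    [/\ A (k + 1) y.1, y.1 <> b & y.2 = x].
Proof.
exists ([set a], [set b] `&` A (k + 1)).
  split; first exact/card_lt_finite/finite_set1.
  split; first exact: subIsetr.
  by have [] := card_lt_finite Linf (finite_setIl (A (k + 1)) (finite_set1 b)).
move=> x y Akx /crossP[->|[yx [Ay ya]]|[[Ay yb] yx]]; [by left|right|right].
  by left.
by right; split=> // E; apply: yb.
Qed.

(** * Separation properties of the extension *)

Lemma starX_accessible : accessible_space (starX L A).
Proof.
move=> p q /eqP pq; exists (~` [set q]); split; last 2 first.
- exact: mem_set.
- by apply/mem_set; rewrite setCK.
apply: open_starXP; split=> [k x Akx /= xq| |].
- case: q pq xq => [[a b]| |] _ xq; first last.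
  + exists (set0, set0); first exact: admissible0.
    by move=> _ [? _ <-] /=.
  + exists (set0, set0); first exact: admissible0.
    by move=> _ [? _ <-] /=.
  have [GF adm GFP] := admissible_avoid k b a; exists GF => //.
  move=> _ [y + <-] /= [yE]; rewrite yE => /(GFP _ _ Akx) /= [ab|[[]|[]]] //.
  by apply: xq; rewrite ab.
- case: q pq => [[a b]| |] _ /= qp; [|by exists 0 => r [->|[? _ <-]]|by []].
  have [k Aka] := block_ex a; exists k => r rk /= rE; rewrite rE in rk.
  by have /(pinfty_base_pt _ (p := (a, b)) Aka) := rk; rewrite ltxx.
- case: q pq => [[a b]| |] _ /= qm; [|by []|by exists 0 => r [->|[? _ <-]]].
  have [k Aka] := block_ex a; exists (k - 1) => r rk /= rE; rewrite rE in rk.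
  by have /(minfty_base_pt _ (p := (a, b)) Aka)[] := rk; lia.
Qed.

(** For z different from x, a common point of the crosses around x and z other
    than their centers is (x, z) or (z, x); dropping x from both arms around z
    removes it. *)
Lemma closed_cross k x G F : A k x -> closed (pt @` cross k x G F).
Proof.
move=> Akx; rewrite -openC; apply: open_starXP; split=> [j z Ajz nz|_|_].
- have zx : z <> x.
    move=> zx; apply: nz; exists (z, z) => //; rewrite zx.
    exact: cross_center.
  have [GF adm GFP] := admissible_avoid j x x; exists GF => //.
  move=> _ [p pz <-] [q /crossP qx [qp]]; rewrite qp in qx.
  have {pz} := GFP _ _ Ajz pz.
  case: qx => [pE|[q1 _]|[_ q2]] [pzE|[[p1 _ p2]|[_ p1 p2]]] //; apply: zx.
  - by have [] : (z, z) = (x, x) by rewrite -pzE.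
  - by rewrite -p1 pE.
  - by case: p1; rewrite pE.
  - by rewrite -q1 pzE.
  - by rewrite -p1.
  - by rewrite -q2 pzE.
  - by rewrite -p2.
- exists (k + 1) => q qk [p /(cross_block Akx) + E]; rewrite -E in qk.
  by case=> Ap; have := (pinfty_base_pt _ Ap).1 qk; lia.
- exists (k - 1) => q qk [p /(cross_block Akx) + E]; rewrite -E in qk.
  by case=> Ap; have [] := (minfty_base_pt _ Ap).1 qk; lia.
Qed.

Lemma pinfty_minfty_disjoint m :
  Upinfty m `&` Uminfty m = set0.
Proof.
rewrite -subset0 => -[p| |] [/= + +]; last 2 first.
- by case=> // -[].
- by move=> _ [|[]].
have [k Ap] := block_ex p.1.
by move=> /(pinfty_base_pt _ Ap) mk /(minfty_base_pt _ Ap)[]; lia.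
Qed.

(** Together with disjointness for equal indices, this separates an infinite
    point from the complement of any of its basic neighbourhoods. *)
Lemma pinfty_minfty_cover m n : m < n ->
  Upinfty m `|` Uminfty n = setT.
Proof.
move=> mn; rewrite -subTset => -[p| |] _; [|by right; left|by left; left].
have [k Ap] := block_ex p.1; have [mk|km] := ltP m k.
  by left; apply/(pinfty_base_pt _ Ap).
by right; apply/(minfty_base_pt _ Ap); split; [lia|case; lia].
Qed.

Lemma starX_regular : regular_space (starX L A).
Proof.
move=> p W; case: p => [[x y]| |] /=.
- have [yx|xy] := pselect (y = x).
    rewrite yx; have [k Akx] := block_ex x => /(nbhs_diag _ Akx)[GF adm sW].
    exists (pt @` cross k x GF.1 GF.2).
      by apply/(nbhs_diag _ Akx); exists GF => // p; exists p.
    rewrite -[closure _](closure_id _).1; first exact/image_subP.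
    exact: closed_cross.
  move=> /nbhs_singleton Wxy; exists [set pt (x, y)].
    by apply: open_nbhs_nbhs; split=> //; apply: open_pt_singleton => /= /esym.
  rewrite -(closure_id _).1; first by move=> _ ->.
  exact: accessible_closed_set1 starX_accessible _.
- move=> /nbhs_minfty[m mW]; exists (Uminfty (m - 1)).
    by apply: open_nbhs_nbhs; split; [exact: open_minfty_base|left].
  apply: subset_trans mW.
  apply: (closure_sub_open (@open_pinfty_base (m - 1))).
    by rewrite setIC pinfty_minfty_disjoint.
  by apply: pinfty_minfty_cover; lia.
- move=> /nbhs_pinfty[m mW]; exists (Upinfty (m + 1)).
    by apply: open_nbhs_nbhs; split; [exact: open_pinfty_base|left].
  apply: subset_trans mW.
  apply: (closure_sub_open (@open_minfty_base (m + 1))).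
    exact: pinfty_minfty_disjoint.
  by rewrite setUC; apply: pinfty_minfty_cover; lia.
Qed.

(** * Failure of complete regularity *)

Lemma nbhs_diag_column k x W : A k x -> nbhs (pt (x, x)) W ->
  exists2 G, card_lt G [set: L] &
    forall y, (A (k - 1) `\` G) y -> W (pt (x, y)).
Proof.
move=> Akx /(nbhs_diag _ Akx)[[G F] [GL _] sW]; exists G => // y Gy.
by apply: (sW (x, y)); left; right.
Qed.

Lemma nbhs_diag_row k x W : A k x -> nbhs (pt (x, x)) W ->
  exists2 F, F #<= [set: L] &
    forall y, (A (k + 1) `\` F) y -> W (pt (y, x)).
Proof.
move=> Akx /(nbhs_diag _ Akx)[[G F] [_ [_ FL]] sW]; exists F => // y Fy.
by apply: (sW (y, x)); right.
Qed.

Hypothesis L_lt_M : card_lt [set: L] [set: M].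

(** Each row over a point x of the sublevel set lies below c' outside at most
    |L| points; over |L| many such x, at most |L| points y of the next block are
    lost, fewer than the |M| available.  For the others, the column of y is
    below c' at |L| points, and a neighbourhood of (y, y) omits fewer than |L|
    of them. *)
Lemma large_sublevel_next_block (R : realType) (f : starX L A -> R) k c c' :
  continuous f -> c < c' ->
  [set: L] #<= [set x | A k x /\ f (pt (x, x)) <= c] ->
  [set: L] #<= [set x | A (k + 1) x /\ f (pt (x, x)) <= c'].
Proof.
move=> cf cc' /card_subP[D DL Dc].
have /choice[F FP] : forall x, exists F : set M, D x -> F #<= [set: L] /\
    forall y, (A (k + 1) `\` F) y -> f (pt (y, x)) < c'.
  move=> x; have [/Dc[Akx fx]|] := pselect (D x); last by exists set0.
  have [F FL Fc] := nbhs_diag_row Akx (cvgr_lt _ (cf _) _ (le_lt_trans fx cc')).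
  by exists F.
pose N := \bigcup_(x in D) F x.
have NL : N #<= [set: L].
  apply: card_bigcup_le_infinite => // [|x /FP[]//].
  by move: DL; rewrite card_eq_le => /andP[].
have Minf : infinite_set [set: M].
  by apply/infiniteP/(card_le_trans _ L_lt_M.1)/infiniteP.
have [/card_le_trans/(_ NL)/L_lt_M.2//|MN] :
    [set: M] #<= N \/ [set: M] #<= A (k + 1) `\` N.
  apply: card_le_setU_infinite => //.
  apply: card_le_trans (card_block (k + 1)) _; apply: subset_card_le => y Ay.
  by have [Ny|nNy] := pselect (N y); [left|right].
apply: card_le_trans L_lt_M.1 (card_le_trans MN (subset_card_le _)).
move=> y [Ay nNy].
split=> //; rewrite leNgt; apply/negP => fy.
have [G GL Gc] := nbhs_diag_column Ay (cvgr_gt _ (cf _) _ fy).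
apply: GL.2; apply: (card_le_trans (B := D)).
  by move: DL; rewrite card_eq_le => /andP[].
apply: subset_card_le => x Dx; apply: contrapT => nGx.
have [Akx _] := Dc _ Dx; have [_ /(_ y)] := FP _ Dx.
have /Gc : (A (k + 1 - 1) `\` G) x by rewrite addrK.
move=> /= c'f /(_ _)/wrap[|]; last by rewrite ltNge ltW.
by split=> // Fy; apply: nNy; exists x.
Qed.

(** A neighbourhood of minus infinity contains a whole block of the diagonal,
    and the previous lemma carries a large sublevel set from block to block, up
    to every neighbourhood of plus infinity. *)
Lemma continuous_pinfty_le_minfty (R : realType) (f : starX L A -> R) :
  continuous f -> f pinfty <= f minfty.
Proof.
move=> cf; rewrite leNgt; apply/negP => fmp.
pose c := (f minfty + f pinfty) / 2; pose c0 := (f minfty + c) / 2.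
have [mc cp] : f minfty < c /\ c < f pinfty by split; rewrite !midf_lt.
have [mc0 c0c] : f minfty < c0 /\ c0 < c by split; rewrite !midf_lt.
have [m mP] := nbhs_minfty (cvgr_lt _ (cf _) _ mc0).
have [n nP] := nbhs_pinfty (cvgr_gt _ (cf _) _ cp).
(* Each step enlarges the bound a little, hence the statement for all d > c0:
   the step to d starts from the midpoint of c0 and d. *)
have level j d : c0 < d ->
    [set: L] #<= [set x | A (m - 1 + j%:Z) x /\ f (pt (x, x)) <= d].
  elim: j d => [|j IHj] d c0d.
    apply: card_le_trans L_lt_M.1 (card_le_trans (card_block (m - 1)) _).
    apply: subset_card_le => x Ax; split; first by rewrite addr0.
    apply/ltW/(lt_trans _ c0d)/(mP (pt (x, x))).
    by apply/(minfty_base_pt _ (p := (x, x)) Ax); split; [lia|case; lia].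
  rewrite -[j.+1]addn1 PoszD addrA.
  apply: (large_sublevel_next_block cf (midf_lt c0d).2).
  exact/IHj/(midf_lt c0d).1.
have [l0 _] := infinite_setN0 Linf.
have /card_leT_fun[g _ /(_ l0) [gA gc]] :=
  level (absz (n - (m - 1))%R).+1 c c0c.
have /nP /= : Upinfty n (pt (g l0, g l0)).
  by apply/(pinfty_base_pt _ (p := (g l0, g l0)) gA); lia.
by rewrite ltNge gc.
Qed.

Lemma starX_not_completely_regular : ~ completely_regular_space (starX L A).
Proof.
have cl : closed [set pinfty].
  exact: accessible_closed_set1 starX_accessible _.
move=> /(completely_regular_functionP Rdefinitions.R)/(_ minfty _ cl).
move=> [//|f [cf _ f0 f1]].
have := continuous_pinfty_le_minfty cf.
have -> : f minfty = 0 by apply: f0; exists minfty.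
have -> : f pinfty = 1 by apply: f1; exists pinfty.
by rewrite ler10.
Qed.

Lemma starX_regular_not_completely_regular :
  regular_not_completely_regular (starX L A).
Proof.
split; first by split; [exact: starX_accessible|exact: starX_regular].
by move=> [_]; exact: starX_not_completely_regular.
Qed.

(** * Small subspaces *)

(** Fewer than |L| points of Z lie on the arms of the cross at p, so an
    admissible cross avoids them all. *)
Lemma small_subspace_isolated (Z : topologicalType) (i : Z -> starX L A) z p :
  card_lt [set: Z] [set: L] -> injective i -> continuous i -> i z = pt p ->
  nbhs z [set z].
Proof.
move=> [ZL LZ] i_inj ci izp.
suff : exists2 V, nbhs (i z) V & forall z', V (i z') -> i z' = i z.
  move=> [V nV sV]; have nz : nbhs z (i @^-1` V) by exact: ci.
  by apply: filterS nz => z' /sV/i_inj.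
have small (e : M -> starX L A) :
    injective e -> [set y | range i (e y)] #<= [set: Z].
  move=> e_inj; apply: (rel_card_le (R := fun y z => i z = e y)).
    by move=> y [z' _ iz']; exists z'.
  by move=> y y' z' _ _ -> /e_inj.
rewrite izp; case: p izp => a b izp.
have [ba|ab] := pselect (b = a); last first.
  exists [set pt (a, b)] => //; apply: open_nbhs_nbhs; split=> //.
  by apply: open_pt_singleton => /= /esym.
rewrite ba in izp *; have [k Aka] := block_ex a.
pose G := [set y | range i (pt (a, y))].
pose F := A (k + 1) `&` [set y | range i (pt (y, a))].
exists (pt @` cross k a G F).
  apply/(nbhs_diag _ Aka); exists (G, F) => [|y]; last by exists y.
  have GZ : G #<= [set: Z] by apply: small => y y' [].
  have FZ : F #<= [set: Z].
    apply: card_le_trans (subset_card_le (@subIsetr _ _ _)) _.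
    by apply: small => y y' [].
  split.
    by split=> [|/card_le_trans/(_ GZ)//]; exact: card_le_trans GZ ZL.
  by split; [exact: subIsetl|exact: card_le_trans FZ ZL].
move=> z' [[u v] /crossP + uvE]; rewrite -uvE.
case=> [[-> ->]//|[/= ua [_ nGv]]|[[/= Au nFu] va]].
  by case: nGv; rewrite /G /= -ua; exists z'.
by case: nFu; split=> //=; rewrite -va; exists z'.
Qed.

(** Only the two infinite points can be non-isolated in Z, so the trace of
    [Upinfty m] is clopen as soon as its complement contains the trace of
    [Uminfty m], and conversely. *)
Lemma small_subspace_clopen (Z : topologicalType) (i : Z -> starX L A) z N :
  card_lt [set: Z] [set: L] -> injective i -> continuous i ->
  accessible_space Z ->
  (exists2 V, nbhs (i z) V & i @^-1` V `<=` N) ->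
  exists U, [/\ clopen U, U z & U `<=` N].
Proof.
move=> ZL i_inj ci T1Z [W nW sW].
have isolated z' : i z' <> minfty -> i z' <> pinfty -> nbhs z' [set z'].
  by case E : (i z') => [p| |] // _ _; exact: small_subspace_isolated E.
have openZ (V : set Z) : (forall z', i z' = minfty \/ i z' = pinfty -> V z' ->
    nbhs z' V) -> open V.
  move=> Vinf; rewrite openE => z' Vz'.
  have [/Vinf/(_ Vz')//|/not_orP[zm zp]] :=
    pselect (i z' = minfty \/ i z' = pinfty).
  by apply: filterS (isolated _ zm zp) => _ ->.
have pm m (q : starX L A) : Upinfty m q -> Uminfty m q -> False.
  move=> qp qm; have /seteqP[/(_ q) + _] := pinfty_minfty_disjoint m.
  by apply; split.
have clopenp m : clopen (i @^-1` Upinfty m).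
  split; first by apply: open_comp (open_pinfty_base m) => y _; exact: (ci y).
  rewrite -openC; apply: openZ => z' [zm _|zp nz'].
    have nm : nbhs z' (i @^-1` Uminfty m).
      apply: ci; apply: open_nbhs_nbhs.
      by split; [exact: open_minfty_base|rewrite zm; left].
    by apply: filterS nm => y ym yp; exact: pm yp ym.
  by case: nz'; rewrite /= zp; left.
have clopenm m : clopen (i @^-1` Uminfty m).
  split; first by apply: open_comp (open_minfty_base m) => y _; exact: (ci y).
  rewrite -openC; apply: openZ => z' [zm nz'|zp _].
    by case: nz'; rewrite /= zm; left.
  have np : nbhs z' (i @^-1` Upinfty m).
    apply: ci; apply: open_nbhs_nbhs.
    by split; [exact: open_pinfty_base|rewrite zp; left].
  by apply: filterS np => y yp ym; exact: pm yp ym.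
case E : (i z) nW => [p| |] nW.
- exists [set z]; split=> //; last first.
    by move=> _ ->; apply: sW; rewrite /= E; exact: nbhs_singleton nW.
  split; last exact: accessible_closed_set1.
  by rewrite openE => _ ->; apply: isolated; rewrite E.
- have [m mW] := nbhs_minfty nW; exists (i @^-1` Uminfty m); split=> //.
    by rewrite /= E; left.
  by move=> y /mW/sW.
- have [m mW] := nbhs_pinfty nW; exists (i @^-1` Upinfty m); split=> //.
    by rewrite /= E; left.
  by move=> y /mW/sW.
Qed.

End StarX.

(** The indicator of a clopen set is continuous. *)
Lemma clopen_base_completely_regular (Z : topologicalType) :
  (forall (z : Z) N, nbhs z N -> exists U, [/\ clopen U, U z & U `<=` N]) ->
  completely_regular_space Z.
Proof.
move=> clbase; apply/(completely_regular_functionP Rdefinitions.R).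
move=> z C clC nCz.
have [U [[oU cU] Uz UC]] : exists U, [/\ clopen U, U z & U `<=` ~` C].
  by apply: clbase; apply: open_nbhs_nbhs; split=> //; exact: closed_openC.
exists (\1_(~` U))%R; split.
- move=> y; apply: cvg_near_cst; have [Uy|nUy] := pselect (U y).
    have : nbhs y U by exact: open_nbhs_nbhs.
    by apply: filterS => x Ux; rewrite !indicE !memNset.
  have : nbhs y (~` U).
    by apply: open_nbhs_nbhs; split=> //; exact: closed_openC.
  by apply: filterS => x Ux; rewrite !indicE !mem_set.
- move=> _ [y _ <-]; rewrite indicE /= in_itv /=.
  by case: (_ \in _); rewrite ?lexx ler01.
- by move=> _ [_ -> <-]; rewrite indicE memNset.
- by move=> _ [y Cy <-]; rewrite indicE mem_set// => /UC.
Qed.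

Lemma homeomorphic_to_subspace_embedding (Z Y : topologicalType) :
  homeomorphic_to_subspace Z Y ->
  exists i : Z -> Y, [/\ injective i, continuous i &
    forall z N, nbhs z N -> exists2 V, nbhs (i z) V & i @^-1` V `<=` N].
Proof.
move=> [B [f [g [cf cg fK gK]]]]; exists (set_val \o f); split.
- by move=> x y /val_inj; exact: can_inj fK x y.
- by move=> z; apply: continuous_comp; [exact: cf|exact: initial_continuous].
- move=> z N zN; have : nbhs (f z) (g @^-1` N) by apply: cg; rewrite fK.
  rewrite nbhsE => -[_ [[V oV <-] Vfz] VN]; exists V.
    exact: open_nbhs_nbhs.
  by move=> y /VN; rewrite /= fK.
Qed.

Lemma card_starX_le (L M : Type) (A : int -> set M) :
  infinite_set [set: M] -> [set: starX L A] #<= [set: M].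
Proof.
move=> Minf; have -> : [set: starX L A] = (range (@starX_pt L M A)) `|`
    [set @starX_minfty L M A; @starX_pinfty L M A].
  apply/seteqP; split=> // -[p| |] _; first by left; exists p.
    by right; left.
  by right; right.
apply: card_setU_le_infinite => //.
  exact: card_le_trans (card_image_le _ _) (card_le_setX_self Minf).
exact: (card_lt_finite Minf (finite_set2 _ _)).1.
Qed.

(** * Non-comparability *)

Theorem mainTheorem2 (L1 L2 K : Type)
    (A1 : int -> set L1) (A2 : int -> set K)
    (omega_lt_L1 : card_lt [set: nat] [set: L1])
    (L1_lt_L2 : card_lt [set: L1] [set: L2])
    (L2_lt_K : card_lt [set: L2] [set: K])
    (partA1 : equipotent_partition A1) (partA2 : equipotent_partition A2) :
  non_comparable_regularity_ranks (starX nat A1) (starX L2 A2).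
Proof.
have L1inf : infinite_set [set: L1] by apply/infiniteP; exact: omega_lt_L1.1.
have L2inf : infinite_set [set: L2].
  by apply/infiniteP; exact: card_le_trans omega_lt_L1.1 L1_lt_L2.1.
split; [exact: starX_regular_not_completely_regular infinite_nat _ _|
        exact: starX_regular_not_completely_regular|].
move=> [Z [[[T1Z _] notCR]]].
move=> /homeomorphic_to_subspace_embedding[i1 [i1_inj _ _]].
move=> /homeomorphic_to_subspace_embedding[i2 [i2_inj ci2 i2_emb]].
apply: notCR; split=> //; apply: clopen_base_completely_regular => z N zN.
apply: (small_subspace_clopen L2inf partA2 _ i2_inj ci2 T1Z);
  last exact: i2_emb.
have ZL1 : [set: Z] #<= [set: L1].
  apply: card_le_trans (card_starX_le nat A1 L1inf).
  by apply: (fun_card_le (f := i1)) => // x y _ _; exact: i1_inj.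
split; first exact: card_le_trans ZL1 L1_lt_L2.1.
by move=> /card_le_trans/(_ ZL1); exact: L1_lt_L2.2.
Qed.
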